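(* Let $\rho$ be a compatible $sl_2(\mathbb{C})$-representation on $A=\bigoplus_{n=0}^{2N}A^n$ and let $\rho_\varepsilon=\rho+\varepsilon[\rho,\varphi]$ be a compatible infinitesimal deformation of $\rho$ (with $\varphi\in\mathrm{End}_{\mathbb{C}}(A)$ homogeneous of degree $0$) such that $L_\varepsilon=L+\varepsilon v$, where $v\in A^2$ acts by multiplication. Let $j\ge 0$ and $n\geq 2j$. Then the variation of the subspace $L^jP^{n-2j}\subset A^n$, which is measured by the natural map $$\tilde\varphi: L^jP^{n-2j}\to\bigoplus_{i\ne j}L^iP^{n-2i},$$ is given by $$\tilde\varphi(L^j(\alpha))=(N-n+j+1)\,L^{j+1}Q^2_v(\alpha)-j\,L^{j-1}Q_v^0(\alpha)\qquad(\alpha\in P^{n-2j}).$$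
   Context: $A=\bigoplus_{n=0}^{2N}A^n$ is a finite dimensional graded $\mathbb{C}$-algebra which is $\mathbb{Z}/2\mathbb{Z}$-commutative (graded commutative) with respect to the grading $A=A^{even}\oplus A^{odd}$. A representation $\rho:sl_2(\mathbb{C})\to \mathrm{End}_{\mathbb{C}}(A)$ is given by the action of the generators $L=\begin{pmatrix}0&0\\1&0\end{pmatrix}$, $\Lambda=\begin{pmatrix}0&1\\0&0\end{pmatrix}$, $B=\begin{pmatrix}1&0\\0&-1\end{pmatrix}$ (their images in $\mathrm{End}_{\mathbb C}(A)$ are denoted by the same letters). It is compatible if $L$ and $\Lambda$ are homogeneous of degree $2$ and $-2$, respectively, $B|_{A^n}=(N-n)\cdot\mathrm{id}$, and $L(\alpha\beta)=L(\alpha)\beta$ for all $\alpha,\beta\in A$. Put $P^m:=\ker(\Lambda:A^m\to A^{m-2})$ (primitive elements); one has the primitive decomposition $A^n=\bigoplus_{j\ge0}L^jP^{n-2j}$. Infinitesimal deformations: for $\varphi\in\mathrm{End}_{\mathbb{C}}(A)$ the deformation $\rho_\varepsilon$ on $A[\varepsilon]=A\otimes\mathbb{C}[\varepsilon]/(\varepsilon^2)$ is $\rho_\varepsilon(X)=(\mathrm{id}+\varepsilon\varphi)^{-1}\rho(X)(\mathrm{id}+\varepsilon\varphi)=\rho(X)+\varepsilon[\rho(X),\varphi]$; $L_\varepsilon=L+\varepsilon[L,\varphi]$, $\Lambda_\varepsilon=\Lambda+\varepsilon[\Lambda,\varphi]$. The condition $L_\varepsilon=L+\varepsilon v$ means that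 $[L,\varphi]$ is multiplication by $v\in A^2$. The map $\tilde\varphi$ is the natural linear map induced by $\varphi$: $\tilde\varphi(x)$ is the projection of $\varphi(x)\in A^n=\bigoplus_{i\ge 0}L^iP^{n-2i}$ onto $\bigoplus_{i\neq j}L^iP^{n-2i}$, for $x\in L^jP^{n-2j}$. The linear maps $Q_v^i:P^m\to P^{m-2i+2}$ ($i\ge0$) are defined by the primitive decomposition $v\alpha=\sum_{i\ge0}L^iQ_v^i(\alpha)$ of the product, for $\alpha\in P^m$. (For $m=N$ the element $Q_v^1(\alpha)\in P^N$ is annihilated by $L$ and is not determined by this; any choice, e.g. $0$, may be taken.) The term with $L^{j-1}$ is zero for $j=0$. *)

(* Defs.v *)
From HB Require Import structures.
From mathcomp Require Import all_boot all_order all_algebra all_field.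
From mathcomp Require Import complex reals.

Set Implicit Arguments.
Unset Strict Implicit.
Unset Printing Implicit Defensive.

Import GRing.Theory.
Local Open Scope ring_scope.

Section Sl2.
Variable F : fieldType.

Definition sl2_space : {vspace 'M[F]_2} :=
  lker (linfun (mxtrace : 'M[F]_2 -> F^o)).

Lemma mem_sl2 (X : 'M[F]_2) : (X \in sl2_space) = (\tr X == 0).
Proof. by rewrite memv_ker lfunE. Qed.

Definition sl2 := subvs_of sl2_space.

Fact sl2_bracket_subproof (X Y : 'M[F]_2) : X *m Y - Y *m X \in sl2_space.
Proof. by rewrite mem_sl2 raddfB /= mxtrace_mulC subrr. Qed.

Definition sl2_bracket (X Y : sl2) : sl2 :=
  Subvs (sl2_bracket_subproof (vsval X) (vsval Y)).

Fact sl2_L_subproof : delta_mx 1 0 \in sl2_space.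
Proof. by rewrite mem_sl2 /mxtrace big_ord_recl big_ord1 !mxE /= addr0. Qed.

Fact sl2_Lam_subproof : delta_mx 0 1 \in sl2_space.
Proof. by rewrite mem_sl2 /mxtrace big_ord_recl big_ord1 !mxE /= addr0. Qed.

Fact sl2_B_subproof : delta_mx 0 0 - delta_mx 1 1 \in sl2_space.
Proof.
by rewrite mem_sl2 /mxtrace big_ord_recl big_ord1 !mxE /= subr0 sub0r subrr.
Qed.

Definition sl2_L : sl2 := Subvs sl2_L_subproof.
Definition sl2_Lam : sl2 := Subvs sl2_Lam_subproof.
Definition sl2_B : sl2 := Subvs sl2_B_subproof.

Lemma sl2_bracket_LamL : sl2_bracket sl2_Lam sl2_L = sl2_B.
Proof. by apply: val_inj; rewrite /= !mul_delta_mx. Qed.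

End Sl2.

Arguments sl2_L {F}.
Arguments sl2_Lam {F}.
Arguments sl2_B {F}.

Section Endo.
Variables (F : fieldType) (V : vectType F).
Implicit Types f g : 'End(V).

Definition lcomm f g : 'End(V) := (f \o g)%VF - (g \o f)%VF.

Definition lpow f (j : nat) : 'End(V) := iter j (comp_lfun f) \1%VF.

Definition sl2_representation (rho : sl2 F -> 'End(V)) : Prop :=
  linear rho /\
  forall X Y : sl2 F, rho (sl2_bracket X Y) = lcomm (rho X) (rho Y).

(* Gradings are indexed by all of int, the pieces outside the range of the
   grading being 0, so that degree shifts need no truncated subtraction. *)
Definition homogeneous (gr : int -> {vspace V}) (d : int) f : Prop :=
  forall n : int, (f @: gr n <= gr (n + d)%R)%VS.

End Endo.

Section Graded.
Variables (F : fieldType) (A : falgType F) (N : nat) (gr : int -> {vspace A}).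

Record graded_algebra : Prop := GradedAlgebra {
  graded_out : forall n : int, ~~ (0 <= n <= (N.*2)%:Z) -> gr n = 0%VS;
  graded_full : (\sum_(n < N.*2.+1) gr n%:Z)%VS = fullv;
  graded_direct : directv (\sum_(n < N.*2.+1) gr n%:Z);
  graded_one : 1 \in gr 0;
  graded_mul : forall (m n : int) (a b : A),
    a \in gr m -> b \in gr n -> a * b \in gr (m + n)
}.

(* A^even for p = false, A^odd for p = true. *)
Definition parity_part (p : bool) : {vspace A} :=
  (\sum_(n < N.*2.+1 | odd n == p) gr n%:Z)%VS.

Definition Z2_commutative : Prop :=
  forall (p q : bool) (a b : A),
    a \in parity_part p -> b \in parity_part q ->
    a * b = (-1) ^+ (p && q) * (b * a).

Record compatible (rho : sl2 F -> 'End(A)) : Prop := Compatible {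
  compat_rep : sl2_representation rho;
  compat_L_deg : homogeneous gr 2 (rho sl2_L);
  compat_Lam_deg : homogeneous gr (- 2) (rho sl2_Lam);
  compat_B : forall (n : int) (x : A),
    x \in gr n -> rho sl2_B x = (N%:Z - n)%:~R *: x;
  compat_L_mul : forall a b : A, rho sl2_L (a * b) = rho sl2_L a * b
}.

End Graded.

(* The algebra A[eps] = A (x) F[eps]/(eps^2):
   Dual a b stands for a + eps b. *)

Record dualnum (A : Type) : Type := Dual { std_part : A; eps_part : A }.

Definition pair_of_dual (A : Type) (x : dualnum A) : A * A :=
  (std_part x, eps_part x).
Definition dual_of_pair (A : Type) (p : A * A) : dualnum A := Dual p.1 p.2.

Fact pair_of_dualK (A : Type) : cancel (@pair_of_dual A) (@dual_of_pair A).
Proof. by case. Qed.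

HB.instance Definition _ (A : choiceType) :=
  Choice.copy (dualnum A) (can_type (@pair_of_dualK A)).

Section DualNumbers.
Variables (F : fieldType) (A : falgType F).
Implicit Types x y z : dualnum A.

Definition dual_zero : dualnum A := Dual 0 0.
Definition dual_opp x := Dual (- std_part x) (- eps_part x).
Definition dual_add x y :=
  Dual (std_part x + std_part y) (eps_part x + eps_part y).
Definition dual_scale (k : F) x := Dual (k *: std_part x) (k *: eps_part x).
Definition dual_one : dualnum A := Dual 1 0.
Definition dual_mul x y :=
  Dual (std_part x * std_part y)
       (std_part x * eps_part y + eps_part x * std_part y).

Fact dual_addA : associative dual_add.
Proof. by case=> a b [c d] [e f]; congr Dual; apply: addrA. Qed.

Fact dual_addC : commutative dual_add.
Proof. by case=> a b [c d]; congr Dual; apply: addrC. Qed.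

Fact dual_add0 : left_id dual_zero dual_add.
Proof. by case=> a b; congr Dual; apply: add0r. Qed.

Fact dual_addN : left_inverse dual_zero dual_opp dual_add.
Proof. by case=> a b; congr Dual; apply: addNr. Qed.

HB.instance Definition _ := GRing.isZmodule.Build (dualnum A)
  dual_addA dual_addC dual_add0 dual_addN.

Fact dual_scaleA (k l : F) x :
  dual_scale k (dual_scale l x) = dual_scale (k * l) x.
Proof. by case: x => a b; congr Dual; apply: scalerA. Qed.

Fact dual_scale1 : left_id 1 dual_scale.
Proof. by case=> a b; congr Dual; apply: scale1r. Qed.

Fact dual_scaleDr : right_distributive dual_scale +%R.
Proof. by move=> k [a b] [c d]; congr Dual; apply: scalerDr. Qed.

Fact dual_scaleDl x : {morph dual_scale^~ x : k l / k + l}.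
Proof. by move=> k l; case: x => a b; congr Dual; apply: scalerDl. Qed.

HB.instance Definition _ := GRing.Zmodule_isLmodule.Build F (dualnum A)
  dual_scaleA dual_scale1 dual_scaleDr dual_scaleDl.

Import VectorInternalTheory.

Fact dual_vect_axiom : Vector.axiom (dim A + dim A) (dualnum A).
Proof.
exists (fun x : dualnum A => row_mx (v2r (std_part x)) (v2r (eps_part x))).
  by move=> k [a b] [c d] /=; rewrite !linearP scale_row_mx add_row_mx.
exists (fun w => Dual (r2v (lsubmx w) : A) (r2v (rsubmx w) : A)) => [[a b]|w] /=.
  by rewrite row_mxKl row_mxKr !v2rK.
by rewrite !r2vK hsubmxK.
Qed.

HB.instance Definition _ :=
  Lmodule_hasFinDim.Build F (dualnum A) dual_vect_axiom.

Fact dual_mulA : associative dual_mul.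
Proof.
case=> a b [c d] [e f]; congr Dual => /=; first exact: mulrA.
by rewrite mulrDl mulrDr !mulrA addrA.
Qed.

Fact dual_mul1l : left_id dual_one dual_mul.
Proof. by case=> a b; congr Dual => /=; rewrite ?mul0r ?addr0 mul1r. Qed.

Fact dual_mul1r : right_id dual_one dual_mul.
Proof. by case=> a b; congr Dual => /=; rewrite ?mulr0 ?add0r mulr1. Qed.

Fact dual_mulDl : left_distributive dual_mul +%R.
Proof.
by case=> a b [c d] [e f]; congr Dual => /=; rewrite !mulrDl // addrACA.
Qed.

Fact dual_mulDr : right_distributive dual_mul +%R.
Proof.
by case=> a b [c d] [e f]; congr Dual => /=; rewrite !mulrDr // addrACA.
Qed.

Fact dual_one_neq0 : dual_one != 0.
Proof. by apply/eqP => -[/eqP]; rewrite oner_eq0. Qed.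

HB.instance Definition _ := GRing.Zmodule_isNzRing.Build (dualnum A)
  dual_mulA dual_mul1l dual_mul1r dual_mulDl dual_mulDr dual_one_neq0.

Fact dual_scaleAl (k : F) x y : k *: (x * y) = (k *: x) * y.
Proof.
case: x y => [a b] [c d]; congr Dual => /=; first exact: scalerAl.
by rewrite scalerDr -!scalerAl.
Qed.

HB.instance Definition _ :=
  GRing.Lmodule_isLalgebra.Build F (dualnum A) dual_scaleAl.

Fact dual_scaleAr (k : F) x y : k *: (x * y) = x * (k *: y).
Proof.
case: x y => [a b] [c d]; congr Dual => /=; first exact: scalerAr.
by rewrite scalerDr -!scalerAr.
Qed.

HB.instance Definition _ :=
  GRing.Lalgebra_isAlgebra.Build F (dualnum A) dual_scaleAr.
HB.instance Definition _ := Algebra_isFalgebra.Build F (dualnum A).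

Fact std_part_linear : linear (@std_part A : dualnum A -> A).
Proof. by []. Qed.

Fact eps_part_linear : linear (@eps_part A : dualnum A -> A).
Proof. by []. Qed.

HB.instance Definition _ :=
  GRing.isLinear.Build F (dualnum A) A _ (@std_part A) std_part_linear.
HB.instance Definition _ :=
  GRing.isLinear.Build F (dualnum A) A _ (@eps_part A) eps_part_linear.

Implicit Types f g phi : 'End(A).

(* f + eps g, acting F[eps]-linearly on A[eps]. *)
Definition eps_fun f g x : dualnum A :=
  Dual (f (std_part x)) (f (eps_part x) + g (std_part x)).

Fact eps_fun_linear f g : linear (eps_fun f g).
Proof.
by move=> k [a b] [c d]; congr Dual => /=;
  rewrite !linearP // scalerDr addrACA.
Qed.

HB.instance Definition _ f g :=
  GRing.isLinear.Build F (dualnum A) (dualnum A) _ (eps_fun f g)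
    (eps_fun_linear f g).

Definition eps_end f g : 'End(dualnum A) := linfun (eps_fun f g).

Lemma eps_endE f g x : eps_end f g x =
  Dual (f (std_part x)) (f (eps_part x) + g (std_part x)).
Proof. by rewrite lfunE. Qed.

Definition eps_grading (gr : int -> {vspace A}) (n : int) :
    {vspace dualnum A} :=
  (linfun (@std_part A) @^-1: gr n
   :&: linfun (@eps_part A) @^-1: gr n)%VS.

Lemma mem_eps_grading gr n x :
  (x \in eps_grading gr n) = (std_part x \in gr n) && (eps_part x \in gr n).
Proof. by rewrite memv_cap -!memv_preim !lfunE. Qed.

Definition deformation (rho : sl2 F -> 'End(A)) (phi : 'End(A)) (X : sl2 F) :
    'End(dualnum A) :=
  eps_end (rho X) (lcomm (rho X) phi).

Lemma eps_end_inv phi :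
  (eps_end \1 phi \o eps_end \1 (- phi))%VF = \1%VF /\
  (eps_end \1 (- phi) \o eps_end \1 phi)%VF = \1%VF.
Proof.
by split; apply/lfunP => -[a b];
  rewrite comp_lfunE !eps_endE !id_lfunE /= opp_lfunE ?addrNK ?addrK.
Qed.

Lemma deformation_conj rho phi X :
  deformation rho phi X =
  (eps_end \1 (- phi) \o (eps_end (rho X) 0 \o eps_end \1 phi))%VF.
Proof.
apply/lfunP => -[a b]; rewrite !comp_lfunE !eps_endE !id_lfunE /=.
by rewrite add_lfunE !opp_lfunE !comp_lfunE zero_lfunE addr0 linearD addrA.
Qed.

End DualNumbers.

Section Primitive.
Variables (F : fieldType) (A : falgType F) (gr : int -> {vspace A}).
Variable rho : sl2 F -> 'End(A).

Definition primitive (m : int) : {vspace A} := (gr m :&: lker (rho sl2_Lam))%VS.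

Definition prim_summand (n : int) (i : nat) : {vspace A} :=
  (lpow (rho sl2_L) i @: primitive (n - i.*2%:Z)%R)%VS.

(* For 0 <= n, the i < nb_summands n are those with 0 <= n - 2 i; the other
   primitive spaces are 0. For n < 0 the whole of A^n is 0. *)
Definition nb_summands (n : int) : nat := (`|n|./2).+1.

(* The projection of phi x to the complement of the j-th summand of A^n. *)
Definition variation (phi : 'End(A)) (n : int) (j : nat) (x : A) : A :=
  daddv_pi (\sum_(i < nb_summands n | (i : nat) != j) prim_summand n i)%VS
           (prim_summand n j) (phi x).

(* Q m i is a linear map P^m -> P^(m - 2 i + 2); the decomposition determines it
   except for i = 1, m = N, where its values in P^N are killed by L. *)
Definition product_components (v : A)
    (Q : forall (m : int) (i : nat),
      'Hom(subvs_of (primitive m), subvs_of (primitive (m - i.*2%:Z + 2)))) :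
    Prop :=
  forall (m : int) (a : subvs_of (primitive m)),
    v * vsval a =
    \sum_(i < nb_summands (m + 2)) lpow (rho sl2_L) i (vsval (Q m i a)).

End Primitive.

(* Main.v *)
Require Import Defs.
From HB Require Import structures.
From mathcomp Require Import all_boot all_order all_algebra all_field.
From mathcomp Require Import complex reals.
From mathcomp Require Import zify.

(** Write ad X for the commutator with rho X; it makes End A an
    sl_2-representation, and [L, phi] = v says that ad L sends phi to
    multiplication by v. Since v and L 1 are even, ad L kills v, so phi is a
    weight-0 vector killed by (ad L)^2: only the trivial and the adjoint
    representation occur in the submodule that phi generates. Concretely, as
    ad L (ad Lam v) = 2 v, the endomorphism
                     phi0 = phi - 1/2 [Lam, v]
    is killed by ad L (lcomm_L_invariant_part), hence also by ad Lam
    (lcomm_Lam_invariant_part), and (ad Lam)^3 v = 0 because v has weight 2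
    for the triple (ad L, ad Lam, - ad B) (iter_lcomm_Lam_amull).

    Now let x be primitive of degree m. Then Lam^k (v x) is the value at x of
    (ad Lam)^k v, so Lam^3 (v x) = 0; as Lam is injective on each L^i P with
    i > 0, this leaves v x = q0 + L q1 + L^2 q2 (mul_primitive_three_terms).
    From phi x = phi0 x + 1/2 Lam (v x) and the formula for Lam on L^i P,
        phi x = phi0 x + (N - m)/2 q1 + (N - m + 1) L q2,
    where phi0 x and q1 lie in P^m. Finally, [L, phi] = v and [L, v] = 0 give
        phi (L^j x) = L^j (phi x) - j L^(j-1) (v x).
    For m = n - 2 j, dropping what lies in L^j P^m leaves
        (N - m + 1 - j) L^(j+1) q2 - j L^(j-1) q0,
    and N - m + 1 - j = N - n + j + 1. Dropping these terms is what the
    projection in variation does because the summands L^i P^(n - 2 i) are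
    independent (prim_summand_direct).

    All the facts about sl_2 come from one computation with a highest weight
    vector (raise_ladder, ladder_eq0), used both in A, where Lam raises and L
    lowers, and in End A, where ad L raises and ad Lam lowers. *)

Set Implicit Arguments.
Unset Strict Implicit.
Unset Printing Implicit Defensive.

Import Order.TTheory GRing.Theory Num.Theory.
Local Open Scope ring_scope.
Local Open Scope complex_scope.

(** * Highest weight vectors *)

Section Ladder.
Variables (F : numFieldType) (V : lmodType F).
Variables (e f : {linear V -> V}) (h : V -> V).
Hypothesis ef_comm : forall y, e (f y) = f (e y) + h y.
Hypothesis hf_comm : forall y, h (f y) = f (h y) - 2 *: f y.

(* x is a highest weight vector of weight c. *)
Variables (c : int) (x : V).
Hypothesis ex0 : e x = 0.
Hypothesis hx : h x = c%:~R *: x.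

Lemma weight_ladder k : h (iter k f x) = (c - k.*2%:Z)%:~R *: iter k f x.
Proof.
elim: k => [|k IHk]; first by rewrite subr0.
rewrite iterS hf_comm IHk linearZ -scalerBl; congr (_ *: _).
rewrite -[2]/(2%:~R) -rmorphB; congr _%:~R; rewrite -!addnn; lia.
Qed.

Lemma raise_ladder k :
  e (iter k.+1 f x) = (k.+1%:Z * (c - k%:Z))%:~R *: iter k f x.
Proof.
elim: k => [|k IHk]; first by rewrite ef_comm ex0 linear0 add0r hx subr0 mul1r.
rewrite iterS ef_comm IHk linearZ weight_ladder -iterS -scalerDl -rmorphD.
congr (_%:~R *: _); rewrite -addnn; lia.
Qed.

(** In characteristic 0 the coefficient of raise_ladder can only vanish at
    k = c. *)
Lemma raise_ladder_eq0 k :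
  e (iter k.+1 f x) = 0 -> c = k%:Z \/ iter k f x = 0.
Proof.
rewrite raise_ladder => /eqP.
rewrite scaler_eq0 intr_eq0 mulf_eq0 subr_eq0 /=.
by case/orP=> /eqP; [left | right].
Qed.

(** The ladder that descends from a highest weight vector stops below weight
    - c: as f^K x = 0 for some K, one climbs back from K with e, and the
    coefficients of raise_ladder do not vanish as long as k > c. For c < 0 and
    k = 0 this says that x itself is 0. *)
Lemma ladder_eq0 K k : iter K f x = 0 -> (c < k%:Z)%R -> iter k f x = 0.
Proof.
have [leKk | ltkK] := leqP K k.
  move=> fK0 _; rewrite -(subnK leKk) iterD fK0.
  by elim: (k - K)%N => //= d ->; rewrite linear0.
elim: K ltkK => // K IHK; rewrite ltnS => le_kK fK0 lt_ck.
have eK0 : e (iter K.+1 f x) = 0 by rewrite fK0 linear0.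
have [cK | fK0'] := raise_ladder_eq0 eK0.
  by move: lt_ck; rewrite cK; lia.
by move: le_kK; rewrite leq_eqVlt => /predU1P[->//|/IHK]; apply.
Qed.
End Ladder.

(** * Commutators of endomorphisms *)

Section Commutator.
Variables (F : fieldType) (V : vectType F).
Implicit Types f g k : 'End(V).

Lemma lcommE f g x : lcomm f g x = f (g x) - g (f x).
Proof. by rewrite /lcomm add_lfunE opp_lfunE !comp_lfunE. Qed.

Fact lcomm_linear f : linear (lcomm f).
Proof.
move=> c g k; apply/lfunP=> x.
rewrite lcommE [RHS]add_lfunE [(c *: lcomm f g) x]scale_lfunE !lcommE.
rewrite !add_lfunE !scale_lfunE linearP.
by rewrite scalerBr opprD addrACA.
Qed.
HB.instance Definition _ f :=
  GRing.isLinear.Build F 'End(V) 'End(V) _ (lcomm f) (lcomm_linear f).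

Lemma lcommN f g : lcomm (- f) g = - lcomm f g.
Proof.
apply/lfunP=> x; rewrite [RHS]opp_lfunE !lcommE !opp_lfunE linearN.
by rewrite opprB opprK addrC.
Qed.

Lemma lcomm_jacobi f g k :
  lcomm f (lcomm g k) = lcomm g (lcomm f k) + lcomm (lcomm f g) k.
Proof.
apply/lfunP=> x; rewrite [RHS]add_lfunE !lcommE.
rewrite !linearB /= !opprK.
set a := f (g (k x)); set b := f (k (g x)); set c := g (k (f x)).
set d := g (f (k x)); set p := k (f (g x)); set q := k (g (f x)).
rewrite [RHS](AC ((2*2)*(2*2)) ((5*3)*(2*8)*((1*6)*(4*7)))) /=.
by rewrite !subrr !addr0.
Qed.

Lemma lpowE f j x : lpow f j x = iter j f x.
Proof.
elim: j => [|j IHj]; first by rewrite id_lfunE.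
by rewrite [LHS]comp_lfunE /= -IHj.
Qed.
End Commutator.

(** * Homogeneous endomorphisms of a graded algebra *)

Section Grading.
Variables (F : fieldType) (A : falgType F) (N : nat) (gr : int -> {vspace A}).
Hypothesis hA : graded_algebra N gr.
Implicit Types f g : 'End(A).

Lemma graded_lfunP f g :
  (forall n x, x \in gr n -> f x = g x) -> f = g.
Proof.
move=> fg; apply/lfunP=> x.
have: x \in fullv by apply: memvf.
rewrite -(graded_full hA) => /memv_sumP[y yP ->].
by rewrite !linear_sum; apply: eq_bigr => i _; apply/(fg i)/yP.
Qed.

Lemma homogeneousP d f n x :
  homogeneous gr d f -> x \in gr n -> f x \in gr (n + d).
Proof. by move=> fd xn; apply: (subvP (fd n)); apply: memv_img. Qed.

(** homogeneousP with the target degree up to an equation, so that degrees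
    need only agree up to linear arithmetic. *)
Lemma homogeneous_mem d f n x m :
  homogeneous gr d f -> x \in gr n -> m = n + d -> f x \in gr m.
Proof. by move=> fd xn ->; apply: homogeneousP. Qed.

Lemma homogeneous_lcomm d e f g :
  homogeneous gr d f -> homogeneous gr e g -> homogeneous gr (d + e) (lcomm f g).
Proof.
move=> fd ge n; apply/subvP=> _ /memv_imgP[x xn ->]; rewrite lcommE.
apply: rpredB.
  by apply: (homogeneous_mem fd (homogeneousP ge xn)); lia.
by apply: (homogeneous_mem ge (homogeneousP fd xn)); lia.
Qed.

Lemma homogeneous_iter_lcomm d e f g k :
  homogeneous gr d f -> homogeneous gr e g ->
  homogeneous gr (d * k%:Z + e) (iter k (lcomm f) g).
Proof.
move=> fd ge; elim: k => [|k IHk]; first by rewrite mulr0 add0r.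
have -> : d * k.+1%:Z + e = d + (d * k%:Z + e) by lia.
exact: homogeneous_lcomm.
Qed.

Lemma amullE (v x : A) : amull v x = v * x.
Proof. exact: lfunE. Qed.

Lemma homogeneous_amull d v : v \in gr d -> homogeneous gr d (amull v).
Proof.
move=> vd n; apply/subvP=> _ /memv_imgP[x xn ->].
by rewrite amullE addrC; apply: (graded_mul hA).
Qed.

Lemma homogeneous_eq0 d f :
  homogeneous gr d f -> (d < - (N.*2)%:Z)%R -> f = 0.
Proof.
move=> fd ltd; apply: graded_lfunP => n x xn; rewrite zero_lfunE.
have fx := homogeneousP fd xn.
have [le_nN | gt_nN] := lerP n (N.*2)%:Z.
  by move: fx; rewrite (graded_out hA) ?memv0 => [/eqP//|]; lia.
by move: xn; rewrite (graded_out hA) ?memv0 => [/eqP->|]; [rewrite linear0|lia].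
Qed.

Lemma graded_iter_eq0 f n x : homogeneous gr 2 f -> x \in gr n ->
  iter (`|N.*2%:Z - n|%N).+1 f x = 0.
Proof.
move=> f2 xn; have iter_gr k : iter k f x \in gr (n + k.*2%:Z).
  elim: k => [|k IHk]; first by rewrite addr0.
  by apply: (homogeneous_mem f2 IHk); lia.
move: (iter_gr (`|N.*2%:Z - n|%N).+1).
by rewrite (graded_out hA) ?memv0 => [/eqP//|]; lia.
Qed.

Lemma graded_even_part n x :
  ~~ odd n -> x \in gr n%:Z -> x \in parity_part N gr false.
Proof.
move=> even_n xn; have [le_nN | gt_nN] := leqP n N.*2; last first.
  by move: xn; rewrite (graded_out hA) ?memv0 => [/eqP->|]; [rewrite mem0v|lia].
have ltn : (n < N.*2.+1)%N by [].
apply: subvP xn; apply: (sumv_sup (Ordinal ltn)) => //=.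
by rewrite (negbTE even_n).
Qed.
End Grading.

(** * The primitive decomposition *)

Section CompatibleRepresentation.
Variables (F : numFieldType) (A : falgType F) (N : nat) (gr : int -> {vspace A}).
Hypothesis hA : graded_algebra N gr.
Variable rho : sl2 F -> 'End(A).
Hypothesis hrho : compatible N gr rho.

Local Notation L := (rho sl2_L).
Local Notation Lam := (rho sl2_Lam).
Local Notation B := (rho sl2_B).
Local Notation P := (primitive gr rho).

Lemma lcomm_Lam_L : lcomm Lam L = B.
Proof. by rewrite -(compat_rep hrho).2 sl2_bracket_LamL. Qed.

Lemma lcomm_L_Lam : lcomm L Lam = - B.
Proof. by rewrite -lcomm_Lam_L /lcomm opprB. Qed.

(** Degree d means weight - d for ad B, since B is N - n in degree n. *)
Lemma lcomm_B d f : homogeneous gr d f -> lcomm B f = (- d)%:~R *: f.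
Proof.
move=> fd; apply: (graded_lfunP hA) => n x xn.
rewrite [RHS]scale_lfunE lcommE (compat_B hrho xn).
rewrite (compat_B hrho (homogeneousP fd xn)) linearZ -scalerBl -rmorphB /=.
by congr (_%:~R *: _); lia.
Qed.

Lemma Lam_L x : Lam (L x) = L (Lam x) + B x.
Proof. by rewrite -lcomm_Lam_L lcommE addrC subrK. Qed.

Lemma B_L x : B (L x) = L (B x) - 2 *: L x.
Proof.
apply/eqP; rewrite addrC -subr_eq -lcommE (lcomm_B (compat_L_deg hrho)).
by rewrite scale_lfunE rmorphN scaleNr.
Qed.

Lemma primitiveP m x : reflect (x \in gr m /\ Lam x = 0) (x \in P m).
Proof. by rewrite memv_cap memv_ker; apply: (iffP andP) => -[? /eqP]. Qed.

Lemma primitive_neg m : (m < 0)%R -> P m = 0%VS.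
Proof. by move=> ltm0; rewrite /primitive (graded_out hA) ?cap0v //; lia. Qed.

Section PrimitiveElement.
Variables (m : int) (x : A).
Hypothesis xP : x \in P m.

Let xm : x \in gr m. Proof. by case/primitiveP: xP. Qed.
Let Lam_x : Lam x = 0. Proof. by case/primitiveP: xP. Qed.

Lemma Lam_iter_L k :
  Lam (iter k.+1 L x) = (k.+1%:Z * (N%:Z - m - k%:Z))%:~R *: iter k L x.
Proof. exact: (raise_ladder Lam_L B_L Lam_x (compat_B hrho xm)). Qed.

(** Lam is injective on L^(k+1) P^m: by raise_ladder_eq0 the only way for it to
    kill L^(k+1) x without L^k x = 0 is N - m = k, and the ladder stops there. *)
Lemma Lam_iter_L_eq0 k : Lam (iter k.+1 L x) = 0 -> iter k.+1 L x = 0.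
Proof.
case/(raise_ladder_eq0 Lam_L B_L Lam_x (compat_B hrho xm)) => [bk | Lk0].
  apply: (ladder_eq0 Lam_L B_L Lam_x (compat_B hrho xm)); last by rewrite bk; lia.
  exact: (graded_iter_eq0 hA (compat_L_deg hrho) xm).
by rewrite iterS Lk0 linear0.
Qed.

Lemma iter_Lam_iter_L k i : (i < k)%N -> iter k Lam (iter i L x) = 0.
Proof.
elim: i k => [|i IHi] [|k] //; rewrite ltnS => lt_ik.
  by rewrite iterSr /= Lam_x; elim: k {lt_ik} => //= k ->; rewrite linear0.
rewrite iterSr Lam_iter_L -lpowE linearZ /= lpowE.
by rewrite IHi // scaler0.
Qed.

Lemma iter_Lam_iter_L_eq0 k i : (k <= i)%N ->
  iter k Lam (iter i L x) = 0 -> iter i L x = 0.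
Proof.
elim: k i => // k IHk [|i] //; rewrite ltnS => le_ki.
rewrite iterSr => LamL0; apply: Lam_iter_L_eq0; move: LamL0.
rewrite Lam_iter_L -lpowE linearZ /= lpowE => /eqP; rewrite scaler_eq0 =>
  /orP[/eqP-> | /eqP/IHk-> //].
  by rewrite scale0r.
by rewrite scaler0.
Qed.
End PrimitiveElement.

(** Apart from independence of the summands L^i P (the case r = 0), this shows
    that only the terms with i < r survive when Lam^r kills the sum. Applying
    Lam up to the exponent K of the top term kills all lower terms, and is
    injective on the top one, which therefore vanishes; then induct on K. *)
Lemma primitive_sum_eq0 r K (d : nat -> int) (q : nat -> A) :
    (forall i, q i \in P (d i)) ->
    iter r Lam (\sum_(i < K) iter i L (q i)) = 0 ->
  forall i, (r <= i < K)%N -> iter i L (q i) = 0.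
Proof.
move=> qP; elim: K => [|K IHK] sum0 i /andP[le_ri lt_iK]; first by [].
have le_rK : (r <= K)%N by apply: leq_trans le_ri _.
have top0 : iter K L (q K) = 0.
  apply: (iter_Lam_iter_L_eq0 (qP K) (leqnn K)).
  have := congr1 (lpow Lam (K - r)%N) sum0.
  rewrite linear0 lpowE -iterD subnK // -lpowE big_ord_recr linearD linear_sum /=.
  rewrite big1 ?add0r ?lpowE // => k _.
  by rewrite lpowE (iter_Lam_iter_L (qP k)).
move: lt_iK; rewrite ltnS leq_eqVlt => /predU1P[-> // | lt_iK].
apply: IHK; last by rewrite le_ri.
by move: sum0; rewrite big_ord_recr /= top0 addr0.
Qed.

Lemma prim_summandP n i y :
  reflect (exists2 x, x \in P (n - i.*2%:Z) & y = iter i L x)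
          (y \in prim_summand gr rho n i).
Proof.
by apply: (iffP memv_imgP) => -[x xP ->]; exists x => //; rewrite lpowE.
Qed.

Lemma prim_summand_direct n K :
  directv (\sum_(i < K) prim_summand gr rho n i).
Proof.
apply/directv_sum_independent => y yP sum0 i _.
have /fin_all_exists2[x xP yE] (k : 'I_K) :
    exists2 x, x \in P (n - k.*2%:Z) & y k = iter k L x.
  exact/prim_summandP/yP.
(* extend x by 0 to a family indexed by nat *)
pose q k := if insub k is Some k' then x k' else 0.
have qE (k : 'I_K) : q k = x k by rewrite /q valK.
rewrite yE -qE.
apply: (@primitive_sum_eq0 0 K (fun k => n - k.*2%:Z) q) => //= [k|].
  by rewrite /q; case: insubP => [k' _ <- | _]; rewrite ?mem0v.
by rewrite -[RHS]sum0; apply: eq_bigr => k _; rewrite qE yE.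
Qed.

Lemma prim_summand_disjoint n (j : nat) K : (j < K)%N ->
  ((\sum_(i < K | (i : nat) != j) prim_summand gr rho n i) :&:
    prim_summand gr rho n j = 0)%VS.
Proof.
move=> ltjK; rewrite capvC.
by have /directv_sumP/(_ (Ordinal ltjK) isT) := prim_summand_direct n K.
Qed.

(** * The adjoint action on endomorphisms *)

(** This and lcomm_B_lcomm_Lam are the relations that make
    (ad L, ad Lam, - ad B) an sl_2-triple acting on End A. *)
Lemma lcomm_L_lcomm_Lam y :
  lcomm L (lcomm Lam y) = lcomm Lam (lcomm L y) + - lcomm B y.
Proof. by rewrite lcomm_jacobi lcomm_L_Lam lcommN. Qed.

Lemma lcomm_B_lcomm_Lam y :
  - lcomm B (lcomm Lam y) = lcomm Lam (- lcomm B y) - 2 *: lcomm Lam y.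
Proof.
rewrite lcomm_jacobi (lcomm_B (compat_Lam_deg hrho)) linearN opprD.
congr (_ - _); apply/lfunP=> x.
by rewrite scale_lfunE !lcommE !scale_lfunE linearZ scalerBr.
Qed.

Lemma lcomm_Lam_nilpotent d f : homogeneous gr d f ->
  exists K, iter K (lcomm Lam) f = 0.
Proof.
move=> fd; exists (N + `|d|%N).+1.
apply: (homogeneous_eq0 hA
  (homogeneous_iter_lcomm _ (compat_Lam_deg hrho) fd)); lia.
Qed.

(** * The deformation *)

Section Deformation.
Variables (phi : 'End(A)) (v : A).
Hypothesis hcomm : Z2_commutative N gr.
Hypothesis hphi : homogeneous gr 0 phi.
Hypothesis hv : v \in gr 2.
Hypothesis L_phi : lcomm L phi = amull v.

(** L is multiplication by L 1, and the even elements v and L 1 commute. *)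
Lemma lcomm_L_amull : lcomm L (amull v) = 0.
Proof.
have L1 y : L y = L 1 * y by rewrite -(compat_L_mul hrho) mul1r.
have L1_gr : L 1 \in gr 2.
  exact: (homogeneous_mem (compat_L_deg hrho) (graded_one hA)).
have even2 y : y \in gr 2 -> y \in parity_part N gr false.
  exact: (@graded_even_part _ _ _ _ hA 2).
apply/lfunP=> x; rewrite lcommE zero_lfunE !amullE (L1 (v * x)) (L1 x) !mulrA.
by rewrite (hcomm (even2 _ hv) (even2 _ L1_gr)) mul1r subrr.
Qed.

(** The component of phi in the trivial representations inside End A; the
    subtracted term is its component in the adjoint ones. *)
Definition invariant_part : 'End(A) := phi - 2^-1 *: lcomm Lam (amull v).

Lemma homogeneous_invariant_part : homogeneous gr 0 invariant_part.
Proof.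
have Lv := homogeneous_lcomm (compat_Lam_deg hrho) (homogeneous_amull hA hv).
move=> n; apply/subvP=> _ /memv_imgP[x xn ->].
rewrite /invariant_part add_lfunE opp_lfunE scale_lfunE rpredB ?rpredZ //.
  exact: homogeneousP.
exact: (homogeneousP Lv).
Qed.

Lemma lcomm_L_invariant_part : lcomm L invariant_part = 0.
Proof.
rewrite /invariant_part linearB linearZ /= L_phi lcomm_jacobi lcomm_L_amull.
rewrite linear0 add0r lcomm_L_Lam lcommN (lcomm_B (homogeneous_amull hA hv)).
by rewrite rmorphN scaleNr opprK scalerA mulVf ?pnatr_eq0 // scale1r subrr.
Qed.

(** [Lam, invariant_part] is a highest weight vector for the triple
    (ad L, ad Lam, - ad B), of negative weight - 2. *)
Lemma lcomm_Lam_invariant_part : lcomm Lam invariant_part = 0.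
Proof.
have wd := homogeneous_lcomm (compat_Lam_deg hrho) homogeneous_invariant_part.
have [K wK] := lcomm_Lam_nilpotent wd.
apply: (@ladder_eq0 _ _ _ _ _ lcomm_L_lcomm_Lam lcomm_B_lcomm_Lam
          (-2) _ _ _ K 0%N wK) => //.
  rewrite /= lcomm_L_lcomm_Lam lcomm_L_invariant_part linear0 add0r.
  by rewrite (lcomm_B homogeneous_invariant_part) oppr0 scale0r oppr0.
by rewrite (lcomm_B wd) addr0 !rmorphN opprK scaleNr.
Qed.

(** Multiplication by v is a highest weight vector of weight 2 for the triple
    (ad L, ad Lam, - ad B). *)
Lemma iter_lcomm_Lam_amull : iter 3 (lcomm Lam) (amull v) = 0.
Proof.
have vd := homogeneous_amull hA hv.
have [K vK] := lcomm_Lam_nilpotent vd.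
apply: (@ladder_eq0 _ _ _ _ _ lcomm_L_lcomm_Lam lcomm_B_lcomm_Lam
          2 _ _ _ K 3%N vK) => //.
  exact: lcomm_L_amull.
by rewrite (lcomm_B vd) rmorphN scaleNr opprK.
Qed.

Lemma phi_iter_L j x :
  phi (iter j L x) = iter j L (phi x) - j%:R *: iter j.-1 L (v * x).
Proof.
have phi_L y : phi (L y) = L (phi y) - v * y.
  by rewrite -amullE -L_phi lcommE opprB addrC subrK.
have v_L y : v * L y = L (v * y).
  apply/eqP; rewrite eq_sym -subr_eq0 -!amullE -lcommE lcomm_L_amull.
  by rewrite zero_lfunE.
have v_iter_L k y : v * iter k L y = iter k L (v * y).
  by elim: k => //= k <-; rewrite v_L.
elim: j => [|j IHj]; first by rewrite scale0r subr0.
rewrite iterS phi_L IHj linearB linearZ /= v_iter_L -addrA -opprD; congr (_ - _).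
case: j {IHj} => [|j]; first by rewrite scale0r add0r scale1r.
by rewrite -iterS -[X in _ + X]scale1r -scalerDl natr1.
Qed.

Lemma iter_Lam_mul_primitive k m x : x \in P m ->
  iter k Lam (v * x) = iter k (lcomm Lam) (amull v) x.
Proof.
case/primitiveP=> _ Lam_x; elim: k => [|k IHk]; first by rewrite amullE.
by rewrite !iterS lcommE Lam_x linear0 subr0 IHk.
Qed.

Lemma invariant_part_primitive m x : x \in P m -> invariant_part x \in P m.
Proof.
case/primitiveP=> xm Lam_x; apply/primitiveP; split.
  by apply: (homogeneous_mem homogeneous_invariant_part xm); rewrite addr0.
have := lcommE Lam invariant_part x.
by rewrite lcomm_Lam_invariant_part Lam_x linear0 subr0 zero_lfunE => <-.
Qed.

(** Lam^3 kills v x, so primitive_sum_eq0 leaves the terms with i < 3. The bound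
    on K makes every P of index i >= K zero, so that the sum can be extended
    to have at least three terms. *)
Lemma mul_primitive_three_terms m x (K : nat) (q : nat -> A) :
    x \in P m -> (forall i, q i \in P (m - i.*2%:Z + 2)) ->
    (`|(m + 2)%R| < K.*2)%N -> v * x = \sum_(i < K) iter i L (q i) ->
  v * x = q 0%N + L (q 1%N) + L (L (q 2%N)).
Proof.
move=> xP qP ltK vx.
have q0 i : (K <= i)%N -> q i = 0.
  move=> leKi; apply/eqP; rewrite -memv0.
  by rewrite -(@primitive_neg (m - i.*2%:Z + 2)); [apply: qP | lia].
have vxE : v * x = \sum_(i < 3 + K) iter i L (q i).
  rewrite addnC big_split_ord /= [X in _ + X]big1 ?addr0 // => i _.
  by rewrite q0 ?leq_addr // -lpowE linear0.
have Lam3_0 : iter 3 Lam (\sum_(i < 3 + K) iter i L (q i)) = 0.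
  by rewrite -vxE (iter_Lam_mul_primitive _ xP) iter_lcomm_Lam_amull zero_lfunE.
rewrite vxE big_split_ord [X in _ + X = _]big1 ?addr0 => [|i _].
  by rewrite !big_ord_recr big_ord0 /= add0r.
apply: (primitive_sum_eq0 (d := fun k => m - k.*2%:Z + 2) qP Lam3_0) => /=.
by have := ltn_ord i; lia.
Qed.

Lemma phi_primitive m x (q : nat -> A) :
    x \in P m -> (forall i, q i \in P (m - i.*2%:Z + 2)) ->
    v * x = q 0%N + L (q 1%N) + L (L (q 2%N)) ->
  phi x = invariant_part x + (2^-1 * (N%:Z - m)%:~R) *: q 1%N
          + (N%:Z - m + 1)%:~R *: L (q 2%N).
Proof.
move=> xP qP vx.
have -> : phi x = invariant_part x + 2^-1 *: Lam (v * x).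
  have /= -> := iter_Lam_mul_primitive 1 xP.
  by rewrite /invariant_part add_lfunE opp_lfunE scale_lfunE subrK.
have /primitiveP[_ Lam_q0] := qP 0%N.
have Lam_q1 : Lam (L (q 1%N)) = (N%:Z - m)%:~R *: q 1%N.
  by rewrite (Lam_iter_L (qP 1%N) 0); congr (_%:~R *: _); lia.
have Lam_q2 : Lam (L (L (q 2%N))) = (2 * (N%:Z - m + 1))%:~R *: L (q 2%N).
  by rewrite (Lam_iter_L (qP 2%N) 1); congr (_%:~R *: _); lia.
rewrite vx !linearD /= Lam_q0 Lam_q1 Lam_q2 scaler0 add0r !scalerA addrA.
by rewrite rmorphM mulrA mulVf ?pnatr_eq0 // mul1r.
Qed.

(** Stated with x and the components q i as elements of A, free of the dependent
    types of the linear maps Q. *)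
Lemma variation_primitive (j n : nat) x (q : nat -> A) :
    (j.*2 <= n)%N -> x \in P (n%:Z - j.*2%:Z) ->
    (forall i, q i \in P (n%:Z - j.*2%:Z - i.*2%:Z + 2)) ->
    v * x = \sum_(i < nb_summands (n%:Z - j.*2%:Z + 2)) iter i L (q i) ->
  variation gr rho phi n%:Z j (iter j L x) =
    (N%:Z - n%:Z + j%:Z + 1)%:~R *: iter j.+1 L (q 2%N)
    - j%:R *: iter j.-1 L (q 0%N).
Proof.
set m := n%:Z - j.*2%:Z => le_jn xP qP vx.
have {vx} vx : v * x = q 0%N + L (q 1%N) + L (L (q 2%N)).
  by apply: (mul_primitive_three_terms xP qP _ vx); rewrite /nb_summands; lia.
set u := (X in _ = X).
(* w is the part of phi (L^j x) inside the j-th summand. *)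
pose y0 := invariant_part x + (2^-1 * (N%:Z - m)%:~R - j%:R) *: q 1%N.
have y0P : y0 \in P m.
  rewrite rpredD ?invariant_part_primitive ?rpredZ //.
  by have := qP 1%N; rewrite subrK.
pose w := iter j L y0.
have phiE : phi (iter j L x) = u + w.
  (* for j = 0 the predecessor j.-1 is wrong, but the coefficient vanishes *)
  have lower y : j%:R *: iter j.-1 L (L y) = j%:R *: iter j L y.
    by case: {xP m qP vx u y0 y0P w le_jn} j => [|i]; rewrite ?scale0r // -iterSr.
  have coefE : (N%:Z - n%:Z + j%:Z + 1)%:~R = (N%:Z - m + 1)%:~R - j%:R :> F.
    by rewrite -[j%:R]/(j%:Z%:~R) -rmorphB; congr _%:~R; rewrite /m; lia.
  rewrite phi_iter_L (phi_primitive xP qP vx) vx /u /w /y0 coefE iterSr.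
  rewrite -!lpowE !linearD !linearZ /= !lpowE !scalerN !lower !scalerBl.
  by rewrite [LHS](AC (3*3) ((3*6)*4*(1*(2*5)))).
set U := (\sum_(i < nb_summands n%:Z | (i : nat) != j)
  prim_summand gr rho n i)%VS.
have ltj : (j < nb_summands n%:Z)%N by rewrite /nb_summands; lia.
have UW0 := prim_summand_disjoint n ltj.
have wW : w \in prim_summand gr rho n j.
  by apply/prim_summandP; exists y0.
have summand_sub i y : i != j -> y \in P (n%:Z - i.*2%:Z) -> iter i L y \in U.
  move=> ij yP; have [lti | gei] := ltnP i (nb_summands n).
    have yi : iter i L y \in prim_summand gr rho n i.
      by apply/prim_summandP; exists y.
    by apply: subvP yi; apply: (sumv_sup (Ordinal lti)).
  (* beyond the index range of U, n - 2 i < 0 and hence y = 0 *)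
  move: yP; rewrite primitive_neg ?memv0 => [/eqP->|]; last first.
    by move: gei; rewrite /nb_summands; lia.
  by rewrite -lpowE linear0 mem0v.
have uU : u \in U.
  rewrite rpredB //.
    rewrite rpredZ // summand_sub //; first by lia.
    by have := qP 2%N; congr (_ \in P _); rewrite /m; lia.
  case: (posnP j) => [-> | j_gt0]; first by rewrite scale0r mem0v.
  rewrite rpredZ // summand_sub //; first by lia.
  by have := qP 0%N; congr (_ \in P _); rewrite /m; lia.
rewrite /variation phiE linearD /= (daddv_pi_id UW0 uU).
have WU0 := UW0; rewrite capvC in WU0.
have w_UW : w \in (U + prim_summand gr rho n j)%VS.
  by apply: subvP wW; apply: addvSr.
have := daddv_pi_add UW0 w_UW.
rewrite (daddv_pi_id WU0 wW) => /(canRL (addrK _)); rewrite subrr => ->.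
by rewrite addr0.
Qed.
End Deformation.

End CompatibleRepresentation.

Theorem proposition1p5 (R : realType) (A : falgType R[i]) (N : nat)
    (gr : int -> {vspace A})
    (hA : graded_algebra N gr) (hcomm : Z2_commutative N gr)
    (rho : sl2 R[i] -> 'End(A)) (hrho : compatible N gr rho)
    (phi : 'End(A)) (hphi : homogeneous gr 0 phi)
    (hdef : compatible N (eps_grading gr) (deformation rho phi))
    (v : A) (hv : v \in gr 2)
    (hLv : deformation rho phi sl2_L = eps_end (rho sl2_L) (amull v))
    (Q : forall (m : int) (i : nat),
      'Hom(subvs_of (primitive gr rho m),
           subvs_of (primitive gr rho (m - i.*2%:Z + 2))))
    (hQ : product_components v Q)
    (j n : nat) (hjn : (j.*2 <= n)%N)
    (a : subvs_of (primitive gr rho (n%:Z - j.*2%:Z))) :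
  variation gr rho phi n%:Z j (lpow (rho sl2_L) j (vsval a)) =
    (N%:Z - n%:Z + j%:Z + 1)%:~R *: lpow (rho sl2_L) j.+1 (vsval (Q _ 2%N a))
    - j%:R *: lpow (rho sl2_L) j.-1 (vsval (Q _ 0%N a)).
Proof.
(* compare the eps-parts of both deformed operators at x + eps 0 *)
have L_phi : lcomm (rho sl2_L) phi = amull v.
  apply/lfunP=> x; have := congr1 (fun f : 'End(dualnum A) => f (Dual x 0)) hLv.
  by rewrite !eps_endE /= linear0 !add0r => -[].
rewrite !lpowE.
apply: (variation_primitive hA hrho hcomm hphi hv L_phi
          (q := fun i => vsval (Q _ i a)) hjn (subvsP a)) => [i|].
  exact: subvsP.
by rewrite hQ; apply: eq_bigr => i _; rewrite lpowE.
Qed.
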